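(* The vertex set of every regular polygon is nearcircumsphere-Ramsey. That is, if $P$ is the vertex set of a regular polygon with circumradius $\rho$, then for every $r\in\mathbb{N}$ and every $\varepsilon>0$ there is an $n\in\mathbb{N}$ such that every $r$-coloring of $\mathbb{S}^n_{\rho+\varepsilon}$ contains a monochromatic congruent copy of $P$.
   Context: For $R>0$, $\mathbb{S}^n_R=\{x\in\mathbb{R}^{n+1}:\|x\|=R\}$. An $r$-coloring is a map to an $r$-element set of colors. A congruent copy of $P$ is an isometric image of $P$. *)

(* Defs.v *)
From mathcomp Require Import all_boot all_order all_algebra.
From mathcomp Require Import all_classical all_reals all_analysis.

Set Implicit Arguments.
Unset Strict Implicit.
Unset Printing Implicit Defensive.

Import Order.TTheory GRing.Theory Num.Theory.
Local Open Scope classical_set_scope.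
Local Open Scope ring_scope.

Definition dotp (R : realType) (d : nat) (x y : 'rV[R]_d) : R :=
  \sum_(i < d) x 0 i * y 0 i.

(* The norm `|x| that MathComp-Analysis puts on 'rV[R]_d is the sup norm, hence
   a separate Euclidean norm. *)
Definition enorm (R : realType) (d : nat) (x : 'rV[R]_d) : R :=
  Num.sqrt (dotp x x).

(* The n-dimensional sphere of radius rho lives in R^(n+1). *)
Definition sphere (R : realType) (n : nat) (rho : R) : set 'rV[R]_n.+1 :=
  [set x | enorm x = rho].
Arguments sphere {R} n rho _.

Definition congruent_copy (R : realType) (d k : nat)
    (P : set 'rV[R]_d) (Q : set 'rV[R]_k) : Prop :=
  exists f : 'rV[R]_d -> 'rV[R]_k,
    (forall x y, P x -> P y -> enorm (f x - f y) = enorm (x - y)) /\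
    Q = f @` P.

(* Vertex sets of regular polygons of circumradius rho, placed arbitrarily in
   R^d: m >= 3 equally spaced points on the circle of centre c and radius rho
   in the plane c + span(u, v), where (u, v) is an orthonormal pair.  The choice
   of (u, v) accounts for every rotation of the polygon. *)
Definition regular_polygon_vertices (R : realType) (d : nat) (rho : R)
    (P : set 'rV[R]_d) : Prop :=
  0 < rho /\
  exists (m : nat) (c u v : 'rV[R]_d),
    [/\ (3 <= m)%N, dotp u u = 1, dotp v v = 1, dotp u v = 0 &
      P = [set c + rho *: (cos (2 * pi * k%:R / m%:R) *: u
                           + sin (2 * pi * k%:R / m%:R) *: v)
          | k in [set k : nat | (k < m)%N]]].

(* rho is meant to be the circumradius of P.  The colourings are the maps
   defined on the sphere only, the set being coerced to the type of its
   elements. *)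
Definition nearcircumsphere_Ramsey (R : realType) (d : nat) (rho : R)
    (P : set 'rV[R]_d) : Prop :=
  forall (r : nat) (eps : R), 0 < eps ->
  exists n : nat, forall chi : sphere n (rho + eps) -> 'I_r,
  exists Q : set 'rV[R]_n.+1,
    [/\ congruent_copy P Q, Q `<=` sphere n (rho + eps) &
      exists i : 'I_r, forall x : sphere n (rho + eps),
        Q (\val x) -> chi x = i].

(* Main.v *)
Require Import Defs.
From mathcomp Require Import all_boot all_order all_algebra.
From mathcomp Require Import all_classical all_reals all_analysis.
From mathcomp Require Import ring lra zify.

(** Write the m-th roots of unity as the residues mod m.  A word x : T -> Z_m
    over a finite set T of positions carrying weights w (nonnegative, of sum 1)
    is realized by the point of R^(2|T|) with coordinates
    A * sqrt (w p) * exp (2 i pi (x p) / m); its norm is A.  A template gives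
    each position a residue and declares the position rotating or constant; its
    row j, for j in Z_m, is the word obtained by adding j at the rotating
    positions.  The m rows of a template form a regular m-gon of circumradius
    A * sqrt theta, where theta is the weight of the rotating positions.  So it
    suffices to find, for theta arbitrarily close to 1, positions and weights
    such that every r-colouring of the words admits a template of rotating
    weight exactly theta whose rows all have the same colour
    ([polygon_mergeable_near]).

    The decisive point is to obtain some theta > 0 that does not depend on the
    number of colours ([polygon_mergeable_exists]).  Templates can then be
    nested ([polygon_mergeable_comp]): if all the rows of a template have the
    same colour in every context and after every shift by a residue v, then
    each constant position of an outer template can be replaced by a shifted
    copy of that inner template, and each rotating position by a fully rotating
    copy of its row 0.  The constant weight passes from 1 - theta to
    (1 - theta)(1 - theta'), and iterating makes it as small as desired.

    To get theta independently of the number of colours, let blocks have states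
    in a finite set Q on which a map tau acts, and suppose that the states q and
    tau (tau q) already have the same colour.  Take one block for each vertex x
    of a cube {0,1}^A with more elements in A than there are colours, and for a
    in A consider the word s_a in which the block x is in the state q or tau q
    according to x a.  Two words s_a and s_a' have the same colour, and they
    differ at exactly half of the blocks.  Freezing the blocks at which they
    agree and letting the others vary yields a block in which q and tau q have
    the same colour, at the price of halving the weight of the varying
    positions ([mergeable_pair]).  For tuples of 2^e letters, repeating this
    with the rotations by 2^(e-1), ..., 2, 1 makes the colour invariant under
    the cyclic rotation of the tuple ([mergeable_rotate]).

    Finally the rows are merged one after the other ([mergeable_turn_upto]).
    When the rows 0, ..., l already have the same colour, arrange m consecutive
    slots of a tuple in the states j, j+1, ..., j+m-1 and give the state 0 to
    the remaining ones: for j <= l+1 the only states outside {0, ..., l} are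
    l+1, ..., m-1, in this order, and passing from j to j+1 moves them one slot
    to the left.  So the rows 0, ..., l+1 are rotations of each other up to
    states that are already merged. *)

Set Implicit Arguments.
Unset Strict Implicit.
Unset Printing Implicit Defensive.
Import Order.TTheory GRing.Theory Num.Theory.
Local Open Scope ring_scope.

(** * Merging states of blocks *)

(** A block on the positions T assigns a code in C to each position; in the
    state q : Q it spells the word p |-> ev (b p) q over L.  The property says
    that for any finite set K of colours there are weighted positions such that
    any colouring of the words admits a block giving the same colour to
    E-related states, in which the weight of each kind i of mark is exactly
    alpha.  The value alpha is fixed before the set of colours. *)
Definition mergeable (R : realFieldType) (L Q : finType) (C I : Type)
    (ev : C -> Q -> L) (mark : I -> C -> R) (alpha : R) (E : Q -> Q -> Prop) :=
  forall K : finType, exists (T : finType) (w : T -> R),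
    [/\ forall p, 0 <= w p, \sum_p w p = 1 &
      forall c : {ffun T -> L} -> K, exists b : T -> C,
        (forall i, \sum_p w p * mark i (b p) = alpha) /\
        (forall q q', E q q' ->
          c [ffun p => ev (b p) q] = c [ffun p => ev (b p) q'])].

Lemma mergeable_sub (R : realFieldType) (L Q : finType) (C I : Type)
    (ev : C -> Q -> L) (mark : I -> C -> R) (alpha : R) (E E' : Q -> Q -> Prop) :
  (forall q q', E' q q' -> E q q') ->
  mergeable ev mark alpha E -> mergeable ev mark alpha E'.
Proof.
move=> EE' mE K; have [T [w [w0 w1 wc]]] := mE K.
exists T, w; split=> // c; have [b [b1 b2]] := wc c.
by exists b; split=> // q q' /EE'; exact: b2.
Qed.

(** Several blocks side by side, labelled by the elements of r, whose states can
    be changed independently of each other.  A block added to a row of blocks is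
    chosen so that its merging holds next to arbitrary words at their positions;
    those blocks, in turn, only have to cope with its finitely many states. *)
Lemma mergeable_seq (R : realFieldType) (L Q : finType) (C I : Type)
    (ev : C -> Q -> L) (mark : I -> C -> R) (alpha : R) (E : Q -> Q -> Prop)
    (J : eqType) (r : seq J) :
  mergeable ev mark alpha E -> uniq r ->
  forall K : finType, exists (T : finType) (w : T -> R) (part : T -> J),
    [/\ forall p, 0 <= w p, forall p, part p \in r,
        forall x, x \in r -> \sum_(p | part p == x) w p = 1 &
      forall c : {ffun T -> L} -> K, exists b : T -> C,
        (forall x i, x \in r ->
          \sum_(p | part p == x) w p * mark i (b p) = alpha) /\
        (forall s s' : J -> Q, (forall x, x \in r -> E (s x) (s' x)) ->
          c [ffun p => ev (b p) (s (part p))] =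
          c [ffun p => ev (b p) (s' (part p))])].
Proof.
move=> mE; elim: r => [_ K|y r IH /= /andP[yr ur] K].
  exists void, (fun _ => 0), (of_void J); split=> //; try by case.
  move=> c; exists (of_void C); split=> // s s' _.
  by congr c; apply/ffunP; case.
(* The positions of the blocks in r are chosen for colours that record all the
   states of the new block, then those of the new block for colours that record
   all the words at the former positions. *)
have [T0 [w0 [part0 [w0ge part0r sum0 col0]]]] := IH ur {ffun Q -> K}.
have [T1 [w1 [w1ge sum1 col1]]] := mE {ffun {ffun T0 -> L} -> K}.
pose part (p : T0 + T1) := if p is inl p0 then part0 p0 else y.
have sumE x (F : T0 + T1 -> R) :
    \sum_(p | part p == x) F p =
    \sum_(p | part0 p == x) F (inl p) + (if y == x then \sum_p F (inr p) else 0).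
  rewrite big_sumType /=; congr (_ + _); case: eqP => // _; exact: big_pred0.
exists (T0 + T1)%type,
  (fun p => match p with inl p0 => w0 p0 | inr p1 => w1 p1 end), part; split.
- by case.
- by case=> [p|p] /=; rewrite inE ?eqxx ?part0r ?orbT.
- move=> x; rewrite inE sumE; case: (eqVneq x y) => [-> _|xy /= xr].
    rewrite sum1 big_pred0 ?add0r// => p.
    by apply/negbTE; apply: contraNneq yr => <-.
  by rewrite addr0 sum0.
move=> c.
pose glue (u : {ffun T0 -> L}) (v : {ffun T1 -> L}) : {ffun T0 + T1 -> L} :=
  [ffun p => match p with inl p0 => u p0 | inr p1 => v p1 end].
have [b1 [b1m b1c]] := col1 (fun v => [ffun u => c (glue u v)]).
have [b0 [b0m b0c]] :=
  col0 (fun u => [ffun q => c (glue u [ffun p => ev (b1 p) q])]).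
exists (fun p => match p with inl p0 => b0 p0 | inr p1 => b1 p1 end); split.
  move=> x i; rewrite inE sumE; case: (eqVneq x y) => [-> _|xy /= xr].
    rewrite b1m big_pred0 ?add0r// => p.
    by apply/negbTE; apply: contraNneq yr => <-.
  by rewrite addr0 b0m.
move=> s s' ss'.
have gE (t : J -> Q) :
    [ffun p => ev (match p with inl p0 => b0 p0 | inr p1 => b1 p1 end)
                  (t (part p))] =
    glue [ffun p => ev (b0 p) (t (part0 p))] [ffun p => ev (b1 p) (t y)].
  by apply/ffunP; case=> p; rewrite !ffunE /= ?ffunE.
have /ffunP/(_ (s y)) := b0c s s' (fun x xr => ss' x (mem_behead (s := y :: r) xr)).
rewrite !ffunE !gE => ->.
have /ffunP/(_ [ffun p => ev (b0 p) (s' (part0 p))]) :=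
  b1c _ _ (ss' y (mem_head _ _)).
by rewrite !ffunE.
Qed.

Lemma mergeable_prod (R : realFieldType) (L Q : finType) (C I : Type)
    (ev : C -> Q -> L) (mark : I -> C -> R) (alpha : R) (E : Q -> Q -> Prop)
    (J K : finType) :
  mergeable ev mark alpha E ->
  exists (T : finType) (w : T -> R) (part : T -> J),
    [/\ forall p, 0 <= w p, forall x, \sum_(p | part p == x) w p = 1 &
      forall c : {ffun T -> L} -> K, exists b : T -> C,
        (forall x i, \sum_(p | part p == x) w p * mark i (b p) = alpha) /\
        (forall s s' : J -> Q, (forall x, E (s x) (s' x)) ->
          c [ffun p => ev (b p) (s (part p))] =
          c [ffun p => ev (b p) (s' (part p))])].
Proof.
move=> mE; have [T [w [part [w0 _ w1 wc]]]] := mergeable_seq mE (enum_uniq J) K.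
exists T, w, part; split=> // [x|c]; first by rewrite w1 ?mem_enum.
have [b [b1 b2]] := wc c; exists b; split=> [x i|s s' ss'].
  by rewrite b1 ?mem_enum.
by apply: b2 => x _; exact: ss'.
Qed.

Lemma sum_part (R : realFieldType) (T J : finType) (part : T -> J) (W : J -> R)
    (F : T -> R) :
  \sum_p W (part p) * F p = \sum_x W x * \sum_(p | part p == x) F p.
Proof.
rewrite (partition_big part xpredT) //=; apply: eq_bigr => x _.
by rewrite mulr_sumr; apply: eq_bigr => p /eqP ->.
Qed.

(** Two distinct coordinate functions of a cube disagree at half of its vertices. *)
Lemma card_cube_half (A : finType) (a a' : A) : a != a' ->
  (#|[set x : {ffun A -> bool} | x a != x a']|.*2 = #|{ffun A -> bool}|)%N.
Proof.
move=> aa'; set S := finset _.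
pose flip (x : {ffun A -> bool}) : {ffun A -> bool} :=
  [ffun z => x z (+) (z == a)].
have flipK : involutive flip.
  by move=> x; apply/ffunP => z; rewrite !ffunE -addbA addbb addbF.
have -> : #|{ffun A -> bool}| = (#|S| + #|~: S|)%N by rewrite cardsC.
rewrite -addnn; congr (_ + _)%N.
have -> : ~: S = flip @: S.
  apply/setP => x; rewrite -{2}[x]flipK mem_imset; last exact: inv_inj.
  rewrite !inE !ffunE eqxx [a' == a]eq_sym (negbTE aa') addbF.
  by case: (x a) (x a') => [] [].
by rewrite card_imset //; exact: inv_inj.
Qed.

(** The equivalence relation generated by E and the pairs (x, tau x) for x in l,
    encoded impredicatively: related states satisfy the same predicates among
    those that are invariant under these pairs. *)
Definition closure_on (Q : eqType) (E : Q -> Q -> Prop) (tau : Q -> Q)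
    (l : seq Q) (q q' : Q) :=
  forall P : Q -> Prop, (forall x y, E x y -> (P x <-> P y)) ->
    (forall x, x \in l -> (P x <-> P (tau x))) -> (P q <-> P q').

(** The halving step: tw is the effect of tau on codes, and cst l is the code of
    a position frozen at the letter l. *)
Lemma mergeable_pair (R : realFieldType) (L Q : finType) (C I : Type)
    (ev : C -> Q -> L) (mark : I -> C -> R) (alpha : R) (E : Q -> Q -> Prop)
    (tau : Q -> Q) (tw : C -> C) (cst : L -> C) (q0 : Q) :
  (forall x q, ev (tw x) q = ev x (tau q)) ->
  (forall i, exists i', forall x, mark i (tw x) = mark i' x) ->
  (forall l q, ev (cst l) q = l) -> (forall i l, mark i (cst l) = 0) ->
  (forall x, E x x) -> (forall x y, E x y -> E (tau x) (tau y)) ->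
  E (tau (tau q0)) q0 ->
  mergeable ev mark alpha E ->
  mergeable ev mark (alpha / 2) (closure_on E tau [:: q0]).
Proof.
move=> evtw marktw evc markc Erefl Etau Ett mE K.
pose A : finType := option K; pose X : finType := {ffun A -> bool}.
have [T [w [part [w0 w1 wc]]]] := mergeable_prod X K mE.
have Xgt0 : 0 < #|X|%:R :> R.
  by rewrite ltr0n; apply/card_gt0P; exists [ffun=> true].
pose N : R := #|X|%:R.
exists T, (fun p => N^-1 * w p); split.
- by move=> p; rewrite mulr_ge0 ?w0// invr_ge0 ltW.
- rewrite (sum_part part (fun=> N^-1) w).
  under eq_bigr do rewrite w1 mulr1.
  by rewrite sumr_const -[_^-1 *+ _]mulr_natr mulVf// gt_eqF.
move=> c; have [b [b1 b2]] := wc c.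
pose s (a : A) (x : X) := if x a then tau q0 else q0.
have [a [a' [aa' saa']]] : exists a a', a != a' /\
    c [ffun p => ev (b p) (s a (part p))] =
    c [ffun p => ev (b p) (s a' (part p))].
  pose f a := c [ffun p => ev (b p) (s a (part p))].
  have /injectivePn[a [a' aa' faa']] : ~~ injectiveb f.
    apply/negP => /injectiveP /leq_card; rewrite card_option.
    by rewrite ltnn.
  by exists a, a'.
(* Where s_a and s_a' agree the block is frozen; elsewhere it is used so that
   the state q0 spells s_a, and the state tau q0 spells s_a' up to E. *)
pose g p := let x := part p in
  if x a != x a' then (if x a then tw (b p) else b p)
  else cst (ev (b p) (s a x)).
pose st q (x : X) := if x a != x a' then (if x a then tau q else q) else s a x.
have gE q : [ffun p => ev (g p) q] = [ffun p => ev (b p) (st q (part p))].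
  apply/ffunP => p; rewrite !ffunE /g /st; case: ifP => _; last exact: evc.
  by case: ifP => _ //; exact: evtw.
exists g; split=> [i|q q' qq'].
  transitivity (\sum_p N^-1 * (w p * mark i (g p))).
    by apply: eq_bigr => p _; rewrite mulrA.
  rewrite (sum_part part (fun=> N^-1) (fun p => w p * mark i (g p))).
  rewrite (bigID (fun x : X => x a != x a')) /= addrC big1 ?add0r; last first.
    move=> x /negbTE xS; rewrite big1 ?mulr0// => p /eqP px.
    by rewrite /g px xS markc mulr0.
  transitivity (\sum_(x : X | x a != x a') N^-1 * alpha).
    apply: eq_bigr => x xS; congr (_ * _).
    have [xa|xa] := boolP (x a).
      have [i' twi] := marktw i; rewrite -(b1 x i').
      by apply: eq_bigr => p /eqP px; rewrite /g px xS xa twi.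
    by rewrite -(b1 x i); apply: eq_bigr => p /eqP px; rewrite /g px xS (negbTE xa).
  rewrite sumr_const -[_ *+ _]mulr_natr.
  have := card_cube_half aa'; rewrite cardsE => /(congr1 (fun n => n%:R : R)).
  rewrite -/X -/N -mul2n natrM => <-.
  have : N != 0 by rewrite gt_eqF.
  rewrite /N; have := card_cube_half aa'; rewrite cardsE -/X => <-.
  rewrite -mul2n natrM; set z := (X in _ * X != 0) => z0.
  have z0' : z != 0 by apply: contraNneq z0 => ->; rewrite mulr0.
  by field.
have cgE q1 q2 : (forall x, E (st q1 x) (st q2 x)) ->
    c [ffun p => ev (g p) q1] = c [ffun p => ev (g p) q2].
  by move=> h; rewrite !gE; exact: b2.
have := qq' (fun y => c [ffun p => ev (g p) y] = c [ffun p => ev (g p) q]).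
case=> [x y xy|x|h _].
- suff -> : c [ffun p => ev (g p) x] = c [ffun p => ev (g p) y] by [].
  apply: cgE => z; rewrite /st; case: ifP => _ //; case: ifP => _ //.
  exact: Etau.
- rewrite inE => /eqP ->.
  suff -> : c [ffun p => ev (g p) q0] = c [ffun p => ev (g p) (tau q0)] by [].
  rewrite !gE; transitivity (c [ffun p => ev (b p) (s a (part p))]).
    apply: b2 => z; rewrite /st /s; case: ifP => _ //; by case: ifP.
  rewrite saa'; apply/esym; apply: b2 => z; rewrite /st /s.
  case: (z a); case: (z a') => /=; first [exact: Erefl | exact: Ett].
- by rewrite h.
Qed.

(** The halving step repeated for all states. *)
Lemma mergeable_all (R : realFieldType) (L Q : finType) (C I : Type)
    (ev : C -> Q -> L) (mark : I -> C -> R) (alpha : R) (E : Q -> Q -> Prop)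
    (tau : Q -> Q) (tw : C -> C) (cst : L -> C) :
  (forall x q, ev (tw x) q = ev x (tau q)) ->
  (forall i, exists i', forall x, mark i (tw x) = mark i' x) ->
  (forall l q, ev (cst l) q = l) -> (forall i l, mark i (cst l) = 0) ->
  (forall x y, E x y -> E (tau x) (tau y)) ->
  (forall x, E (tau (tau x)) x) ->
  mergeable ev mark alpha E -> 0 < alpha ->
  exists2 alpha', 0 < alpha' &
    mergeable ev mark alpha' (closure_on E tau (enum Q)).
Proof.
move=> evtw marktw evc markc Etau Ett mE a0.
suff H r : exists2 alpha', 0 < alpha' & mergeable ev mark alpha' (closure_on E tau r).
  exact: H.
elim: r => [|q0 r [al al0 IH]].
  exists alpha => // K; have [T [w [w0 w1 wc]]] := mE K.
  exists T, w; split=> // c; have [b [b1 b2]] := wc c.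
  exists b; split=> // q q' qq'.
  have [x y xy|//|h _] := qq' (fun y => c [ffun p => ev (b p) y] = c [ffun p => ev (b p) q]).
    by rewrite (b2 _ _ xy).
  by rewrite h.
exists (al / 2); first by rewrite divr_gt0.
apply: mergeable_sub (mergeable_pair (q0 := q0) evtw marktw evc markc _ _ _ IH).
- move=> q q' qq' P PE Pq0; apply: qq' => [x y xy|x].
    by apply: PE => P' PE' _; exact: PE'.
  rewrite inE => /orP[/eqP ->|xr]; first by apply: Pq0; rewrite inE.
  by apply: PE => P' _ /(_ x xr).
- by move=> x P.
- move=> x y xy P PE Pr; apply: (xy (P \o tau)) => [u v uv|u ur] /=.
    by apply: PE; exact: Etau.
  rewrite -(Pr u ur); apply: iff_sym; exact: PE.
- by move=> P PE _; exact: PE.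
Qed.

(** * Invariance under rotation of tuples *)

(** Cyclic rotation of the slots of a tuple by t. *)
Definition rotate (L : finType) (M t : nat) (u : {ffun 'I_M -> L}) :
  {ffun 'I_M -> L} := [ffun i => u (iter t (@ordS M) i)].

Lemma val_iter_ordS M t (i : 'I_M) : val (iter t (@ordS M) i) = ((i + t) %% M)%N.
Proof.
elim: t => [|t IH] /=; first by rewrite addn0 modn_small.
by rewrite [nat_of_ord _]IH -addn1 modnDml addn1 addnS.
Qed.

Lemma rotateD (L : finType) M t t' (u : {ffun 'I_M -> L}) :
  rotate t (rotate t' u) = rotate (t' + t) u.
Proof. by apply/ffunP => i; rewrite !ffunE iterD. Qed.

Lemma rotate_full (L : finType) M (u : {ffun 'I_M -> L}) : rotate M u = u.
Proof.
apply/ffunP => i; rewrite ffunE; congr (u _); apply: val_inj.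
by rewrite val_iter_ordS modnDr modn_small.
Qed.

(** Codes for blocks whose states are tuples of M letters: a position repeats the
    letter in some slot of the tuple, or is constant. *)
Definition slot_eval (L : finType) (M : nat) (x : 'I_M + L)
  (u : {ffun 'I_M -> L}) : L := match x with inl i => u i | inr l => l end.

(** The marks of kind i are the positions that repeat slot i. *)
Definition slot_mark (R : realFieldType) (L : finType) (M : nat) (i : 'I_M)
  (x : 'I_M + L) : R := (x == inl i)%:R.

(** The weight alpha is the same for all slots: the halving steps only permute
    the slots cyclically, and the initial block repeats each slot once. *)
Lemma mergeable_rotate (R : realFieldType) (L : finType) (e : nat) :
  exists2 alpha : R, 0 < alpha &
    mergeable (@slot_eval L (2 ^ e)) (@slot_mark R L (2 ^ e)) alpha
      (fun u u' => u' = rotate 1 u).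
Proof.
set M := (2 ^ e)%N.
(* At stage i the colour is invariant under the rotation by 2 ^ (e - i). *)
suff H i : (i <= e)%N -> exists2 alpha : R, 0 < alpha &
    mergeable (@slot_eval L M) (@slot_mark R L M) alpha
      (fun u u' => forall P : _ -> Prop,
         (forall x, P x <-> P (rotate (2 ^ (e - i)) x)) -> (P u <-> P u')).
  have [al al0 mal] := H e (leqnn e); exists al => //.
  apply: mergeable_sub mal => u _ -> P; rewrite subnn; exact.
elim: i => [_|i IH ie].
  exists M%:R^-1; first by rewrite invr_gt0 ltr0n expn_gt0.
  have M0 : M%:R != 0 :> R by rewrite pnatr_eq0 -lt0n expn_gt0.
  move=> K; exists 'I_M, (fun=> M%:R^-1); split.
  - by move=> _; rewrite invr_ge0 ler0n.
  - by rewrite sumr_const card_ord -[_ *+ _]mulr_natr mulVf.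
  - move=> c; exists inl; split=> [j|q q' qq'].
      rewrite (bigD1 j) //= big1 ?addr0 /slot_mark ?eqxx ?mulr1// => p /negbTE pj.
      by rewrite (inj_eq (@inl_inj _ _)) pj mulr0.
    suff -> : q = q' by [].
    have [|h _] := qq' (fun x => q = x); last exact: h.
    by move=> x; rewrite subn0 rotate_full.
have [al al0 mal] := IH (ltnW ie).
pose t := (2 ^ (e - i.+1))%N.
have tt : (2 ^ (e - i) = t + t)%N.
  by rewrite /t addnn -mul2n -expnS; congr (_ ^ _)%N; lia.
pose tw (x : 'I_M + L) : 'I_M + L :=
  match x with inl j => inl (iter t (@ordS M) j) | inr l => inr l end.
have [] := @mergeable_all R L _ _ _ _ _ al _ (@rotate L M t) tw inr
  _ _ _ _ _ _ mal al0.
- by case=> [j|l] u //=; rewrite ffunE.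
- move=> j; exists (iter t (@ord_pred M) j) => -[j'|l] //=.
  rewrite /slot_mark /= !(inj_eq (@inl_inj _ _)).
  have SK n (a : 'I_M) : iter n (@ord_pred M) (iter n (@ordS M) a) = a.
    by elim: n a => //= n IHn a; rewrite -iterS iterSr /= ordSK IHn.
  have KS n (a : 'I_M) : iter n (@ordS M) (iter n (@ord_pred M) a) = a.
    by elim: n a => //= n IHn a; rewrite -iterS iterSr /= ord_predK IHn.
  by rewrite (can2_eq (SK t) (KS t)).
- by [].
- by move=> j l.
- move=> x y xy P PE.
  apply: (xy (fun z => P (rotate t z))) => z.
  rewrite (PE (rotate t z)) !rotateD.
  by rewrite addnC.
- move=> x P PE; rewrite rotateD -tt; apply: iff_sym; exact: PE.
- move=> al' al'0 mal'; exists al' => //.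
  apply: mergeable_sub mal' => u u' uu' P _ Pt.
  by apply: uu' => x; apply: Pt; rewrite mem_enum.
Qed.

(** * Merging the rows of templates *)

(** A template on T is a function from T to pairs (rotating?, residue); turn x j
    is the letter that a position of code x shows in row j.  Residues modulo
    n.+1 are the elements of 'I_n.+1. *)
Definition turn (n : nat) (x : bool * 'I_n.+1) (j : 'I_n.+1) : 'I_n.+1 :=
  x.2 + (if x.1 then j else 0).

(** The single kind of mark is carried by the rotating positions. *)
Definition turn_mark (R : realFieldType) (n : nat) (_ : unit)
  (x : bool * 'I_n.+1) : R := if x.1 then 1 else 0.

Lemma modn_wrap_leq (a b l n : nat) : (a < n)%N -> (b <= l.+1)%N -> (l < n)%N ->
  (n <= a + b)%N -> ((a + b) %% n <= l)%N.
Proof.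
move=> an bl ln h; rewrite -(subnK h) modnDr modn_small; lia.
Qed.

(** Rows 0, ..., l of some template have the same colour. *)
Lemma mergeable_turn_upto (R : realFieldType) (n l : nat) : (l <= n)%N ->
  exists2 theta : R, 0 < theta &
    mergeable (@turn n) (@turn_mark R n) theta
      (fun j j' => j = j' \/ (j <= l)%N /\ (j' <= l)%N).
Proof.
elim: l => [_|l IH ln].
  exists 1 => // K; exists unit, (fun=> 1); split=> //.
    by rewrite big_const card_unit /= addr0.
  move=> c; exists (fun=> (true, 0)); split=> [i|j j'].
    by rewrite big_const card_unit /= addr0 mulr1.
  move=> [-> //|]; rewrite !leqn0 => -[/eqP j0 /eqP j'0].
  by congr c; apply/ffunP => p; rewrite !ffunE; congr (_ + _); apply: val_inj; rewrite /= j0 j'0.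
have [th th0 mth] := IH (ltnW ln).
pose e := n.+1; pose M := (2 ^ e)%N.
have nM : (n < M)%N by exact: ltnW (ltn_expl _ _).
have [al al0 mal] := mergeable_rotate R 'I_n.+1 e.
exists ((n.+1)%:R * al * th); first by rewrite !mulr_gt0.
move=> K; have [Tc [wc [wc0 wc1 colc]]] := mal K.
have [T [w [part [w0 w1 col]]]] := mergeable_prod Tc K mth.
exists T, (fun p => wc (part p) * w p); split.
- by move=> p; rewrite mulr_ge0.
- by rewrite sum_part -[RHS]wc1; apply: eq_bigr => x _; rewrite w1 mulr1.
move=> c; have [b [b1 b2]] := col c.
have [B [B1 B2]] :=
  colc (fun s => c [ffun p => turn (b p) (s (part p))]).
(* In row j the tuple shows the states j, j+1, ..., j+n in its first n+1 slots. *)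
pose u (j : 'I_n.+1) : {ffun 'I_M -> 'I_n.+1} :=
  [ffun i : 'I_M => if (i < n.+1)%N then inord i + j else 0].
pose g p : bool * 'I_n.+1 := match B (part p) with
  | inl i => if (i < n.+1)%N then ((b p).1, (b p).2 + (if (b p).1 then inord i else 0))
             else (false, turn (b p) 0)
  | inr v => (false, turn (b p) v) end.
have gE j : [ffun p => turn (g p) j] =
    [ffun p => turn (b p) (slot_eval (B (part p)) (u j))].
  apply/ffunP => p; rewrite !ffunE /g; case: (B (part p)) => [i|v] /=.
    rewrite ffunE; case: ifP => _; rewrite /turn /= ?addr0//.
    by case: (b p).1 => /=; rewrite ?addr0// addrA.
  by rewrite /turn /= addr0.
exists g; split=> [i|].
  transitivity (\sum_p wc (part p) * (w p * turn_mark R i (g p))).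
    by apply: eq_bigr => p _; rewrite mulrA.
  rewrite (sum_part part wc (fun p => w p * turn_mark R i (g p))).
  pose F (x : Tc) : R :=
    \sum_(k : 'I_M | (k < n.+1)%N) slot_mark R k (B x).
  transitivity (\sum_x wc x * (F x * th)).
    apply: eq_bigr => x _; congr (_ * _).
    case E : (B x) => [k|v].
      have FE : F x = (k < n.+1)%:R.
        rewrite /F E /slot_mark; case kn: (k < n.+1)%N.
          rewrite (bigD1 k) //= eqxx big1 ?addr0// => k' /andP[_ /negbTE kk'].
          by rewrite (inj_eq (@inl_inj _ _)) eq_sym kk'.
        rewrite big1 // => k' k'n; rewrite (inj_eq (@inl_inj _ _)).
        by case: eqP => // kk'; rewrite kk' k'n in kn.
      rewrite FE -(b1 x i) /turn_mark; case kn : (k < n.+1)%N; last first.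
        rewrite mul0r big1 // => p /eqP px; rewrite /g px E kn /= mulr0 //.
      rewrite mul1r; apply: eq_bigr => p /eqP px; by rewrite /g px E kn.
    have -> : F x = 0 by rewrite /F big1 // => k _; rewrite E.
    rewrite mul0r.
    by rewrite big1 // => p /eqP px; rewrite /turn_mark /g px E /= mulr0.
  under eq_bigr do rewrite mulrA.
  rewrite -mulr_suml; congr (_ * _).
  rewrite /F; under eq_bigr do rewrite mulr_sumr.
  rewrite exchange_big /=; under eq_bigr do rewrite B1.
  rewrite sumr_const -[LHS]mulr_natl; congr (_%:R * _).
  rewrite -[RHS](card_ord n.+1) -(fintype.card_image (f := widen_ord nM)); last first.
    by move=> x y /(congr1 val) /= /val_inj.
  apply: eq_card => k; rewrite unfold_in; apply/idP/fintype.imageP => [kn|[k' _ ->]].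
    by exists (Ordinal kn) => //; apply: val_inj.
  exact: (ltn_ord k').
(* Row j agrees with the rotation of row 0 by j, up to the states 0, ..., l. *)
have key (j : 'I_n.+1) : (j <= l.+1)%N ->
    c [ffun p => turn (g p) j] = c [ffun p => turn (g p) 0].
  move=> jl.
  pose d (v : {ffun 'I_M -> 'I_n.+1}) :=
    c [ffun p => turn (b p) (slot_eval (B (part p)) v)].
  have dE v : d v = c [ffun p => turn (b p) ([ffun x => slot_eval (B x) v] (part p))].
    by congr c; apply/ffunP => p; rewrite !ffunE.
  have drot v t : d (rotate t v) = d v.
    elim: t => [|t IHt].
      by congr d; apply/ffunP => k; rewrite ffunE.
    have -> : rotate t.+1 v = rotate 1 (rotate t v) by rewrite rotateD addn1.
    rewrite -IHt !dE; symmetry; exact: (B2 (rotate t v) (rotate 1 (rotate t v)) erefl).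
  rewrite !gE; transitivity (d (rotate j (u 0))); last exact: drot.
  apply: (b2 (fun x => slot_eval (B x) (u j))
             (fun x => slot_eval (B x) (rotate j (u 0)))) => x.
  case: (B x) => [k|v] /=; last by left.
  rewrite !ffunE val_iter_ordS.
  have jn : (j <= n)%N by exact: leq_trans jl ln.
  have kM := ltn_ord k.
  have valE (a : nat) : (a < n.+1)%N -> val (inord a + j : 'I_n.+1) = ((a + j) %% n.+1)%N.
    by move=> an; rewrite /= inordK.
  have [kj|kj] := ltnP (k + j)%N M.
    rewrite (modn_small kj); case: ifP => kn; case: ifP => kjn.
    - left; apply: val_inj; rewrite valE // addr0 /= inordK// modn_small//.
    - right; split=> //; rewrite -[nat_of_ord _]/(val _) valE//.
      move/negbT: kjn; rewrite -leqNgt => kjn.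
      exact: modn_wrap_leq kn jl (ltnW ln) kjn.
    - by move/negbT: kn; rewrite -leqNgt => kn; rewrite ltnNge (leq_trans kn (leq_addr _ _)) in kjn.
    - by left.
  have lM : (l < M)%N by exact: ltn_trans ln nM.
  have kjl := modn_wrap_leq kM jl lM kj.
  right; split.
    case: ifP => // kn; rewrite -[nat_of_ord _]/(val _) valE//.
    exact: modn_wrap_leq kn jl (ltnW ln) (leq_trans nM kj).
  by case: ifP => // kn; rewrite addr0 inordK.
move=> j j' [-> //|[jl j'l]]; by rewrite (key j) // (key j').
Qed.

(** * Templates with almost all positions rotating *)

(** Every finite colouring admits a template of rotating weight theta all of
    whose rows have the same colour. *)
Definition polygon_mergeable (R : realFieldType) (n : nat) (theta : R) :=
  mergeable (@turn n) (@turn_mark R n) theta (fun _ _ => True).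

Lemma polygon_mergeable_exists (R : realFieldType) (n : nat) :
  exists2 theta : R, 0 < theta & polygon_mergeable n theta.
Proof.
have [th th0 mth] := mergeable_turn_upto R (leqnn n); exists th => //.
apply: mergeable_sub mth => j j' _; right.
by split; rewrite -ltnS ltn_ord.
Qed.

(** The rows can be merged simultaneously for all the shifts of the template by
    a residue, by recording as a colour the colours of all shifts. *)
Lemma mergeable_shift (R : realFieldType) (n : nat) (theta : R) :
  polygon_mergeable n theta ->
  mergeable (fun x (q : 'I_n.+1 * 'I_n.+1) => q.1 + turn x q.2)
    (@turn_mark R n) theta (fun q q' => q.1 = q'.1).
Proof.
move=> mth K; have [T [w [w0 w1 wc]]] := mth {ffun 'I_n.+1 -> K}.
exists T, w; split=> // c.
have [b [b1 b2]] := wc (fun x => [ffun v => c [ffun p => v + x p]]).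
exists b; split=> // -[v j] [_ j'] /= <-.
have /ffunP/(_ v) := b2 j j' Logic.I; rewrite !ffunE.
have E i : [ffun p => v + [ffun p0 => turn (b p0) i] p] = [ffun p => v + turn (b p) i].
  by apply/ffunP => p; rewrite !ffunE.
by rewrite !E.
Qed.

(** Nesting of templates. *)
Lemma polygon_mergeable_comp (R : realFieldType) (n : nat) (th th' : R) :
  polygon_mergeable n th -> polygon_mergeable n th' ->
  polygon_mergeable n (th + (1 - th) * th').
Proof.
move=> mth /mergeable_shift mth' K.
have [Tm [wm [wm0 wm1 colm]]] := mth K.
have [T [w [part [w0 w1 col]]]] := mergeable_prod Tm K mth'.
exists T, (fun p => wm (part p) * w p); split.
- by move=> p; rewrite mulr_ge0.
- by rewrite sum_part -[RHS]wm1; apply: eq_bigr => x _; rewrite w1 mulr1.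
move=> c; have [b [b1 b2]] := col c.
have [B [B1 B2]] := colm (fun s => c [ffun p => s (part p) + turn (b p) 0]).
(* Rotating positions of the outer template B receive the rotating copy of row
   0 of the inner block, constant ones the shifted inner block itself. *)
pose g p : bool * 'I_n.+1 :=
  if (B (part p)).1 then (true, (B (part p)).2 + turn (b p) 0)
  else ((b p).1, (B (part p)).2 + (b p).2).
exists g; split=> [i|].
  transitivity (\sum_p wm (part p) * (w p * turn_mark R i (g p))).
    by apply: eq_bigr => p _; rewrite mulrA.
  rewrite (sum_part part wm (fun p => w p * turn_mark R i (g p))).
  transitivity (\sum_x (wm x * turn_mark R i (B x) +
                        (wm x - wm x * turn_mark R i (B x)) * th')).
    apply: eq_bigr => x _; rewrite /turn_mark.
    case E : (B x).1.
      rewrite mulr1 subrr mul0r addr0.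
      transitivity (wm x * \sum_(p | part p == x) w p); last by rewrite w1 mulr1.
      congr (_ * _).
      by apply: eq_bigr => p /eqP px; rewrite /g px E /= mulr1.
    rewrite mulr0 subr0 add0r -(b1 x i); congr (_ * _).
    by apply: eq_bigr => p /eqP px; rewrite /g px E.
  by rewrite big_split /= -mulr_suml sumrB B1 wm1.
have key j : c [ffun p => turn (g p) j] =
    c [ffun p => turn (B (part p)) j + turn (b p) 0].
  transitivity (c [ffun p => (if (B (part p)).1 then turn (B (part p)) j else (B (part p)).2)
      + turn (b p) (if (B (part p)).1 then 0 else j)]).
    congr c; apply/ffunP => p; rewrite !ffunE /g.
    case: (B (part p)) => -[] v /=; rewrite /turn /=.
      by rewrite addrAC.
    by rewrite addrA.
  rewrite (b2 (fun x => (if (B x).1 then turn (B x) j else (B x).2,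
                         if (B x).1 then 0 else j))
              (fun x => (turn (B x) j, 0))) //= => x.
  by case: (B x) => -[] v //=; rewrite /turn /= addr0.
move=> j j' _; rewrite !key.
have E i : [ffun p => turn (B (part p)) i + turn (b p) 0] =
    [ffun p => [ffun x => turn (B x) i] (part p) + turn (b p) 0].
  by apply/ffunP => p; rewrite !ffunE.
by rewrite !E; exact: B2.
Qed.

Lemma polygon_mergeable_near (R : archiRealFieldType) (n : nat) (e : R) :
  0 < e -> exists theta : R,
    [/\ 0 < theta, 1 - e <= theta, theta <= 1 & polygon_mergeable n theta].
Proof.
move=> e0; have [th th0 mth] := polygon_mergeable_exists R n.
have th1 : th <= 1.
  have [T [w [w0 w1 wc]]] := mth unit.
  have [b [b1 _]] := wc (fun=> tt).
  rewrite -(b1 tt) -w1; apply: ler_sum => p _.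
  by rewrite ler_piMr // /turn_mark; case: (_.1).
suff [k hk] : exists k, (1 - th) ^+ k.+1 <= e.
  exists (1 - (1 - th) ^+ k.+1).
  have pge0 i : 0 <= (1 - th) ^+ i by rewrite exprn_ge0 // subr_ge0.
  have p1 i : (1 - th) ^+ i.+1 < 1.
    rewrite exprn_ilt1 ?subr_ge0//; lra.
  split.
  - by rewrite subr_gt0.
  - by rewrite lerB.
  - by rewrite lerBlDr lerDl.
  - elim: k {hk} => [|k IH].
      by rewrite expr1 subKr.
    have := polygon_mergeable_comp mth IH.
    have -> // : th + (1 - th) * (1 - (1 - th) ^+ k.+1) = 1 - (1 - th) ^+ k.+2.
    by rewrite [_ ^+ k.+2]exprS; ring.
(* Bernoulli's inequality for (1 - th) ^+ k. *)
have bern k : (1 - th) ^+ k * (1 + k%:R * th) <= 1.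
  elim: k => [|k IH]; first by rewrite expr0 mul0r addr0 mulr1.
  apply: le_trans IH; rewrite exprSr -mulrA ler_wpM2l ?exprn_ge0 ?subr_ge0//.
  rewrite -natr1; have k0 : 0 <= k%:R :> R by [].
  have : 0 <= (k%:R + 1) * th ^+ 2 by rewrite mulr_ge0 ?sqr_ge0// addr_ge0.
  by lra.
pose k := Num.bound ((e * th)^-1); exists k.
have := archi_boundP (ltW (_ : 0 < (e * th)^-1)); rewrite invr_gt0 mulr_gt0//.
move=> /(_ isT); rewrite -/k => hk.
have k1 : 1 <= e * (1 + k.+1%:R * th).
  have : 1 < k%:R * (e * th) by rewrite -ltr_pdivrMr ?mulr_gt0// div1r.
  rewrite -natr1; have := mulr_gt0 e0 th0; lra.
have pos : 0 < 1 + k.+1%:R * th by rewrite ltr_wpDr// mulr_ge0 // ltW.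
rewrite -(ler_pM2r pos); exact: le_trans (bern _) k1.
Qed.

(** * Realization on spheres *)

Local Open Scope classical_set_scope.

Definition angle (R : realType) (n k : nat) : R := 2 * pi * k%:R / n.+1%:R.

(** Squared distance between the points of arguments x and y on the unit circle. *)
Definition chord2 (R : realType) (x y : R) : R :=
  (cos x - cos y) ^+ 2 + (sin x - sin y) ^+ 2.

Lemma chord2_rot (R : realType) (a x y : R) :
  chord2 (a + x) (a + y) = chord2 x y.
Proof.
rewrite /chord2 !cosD !sinD; have := cos2Dsin2 a.
set c := cos a; set s := sin a => cs.
transitivity ((c ^+ 2 + s ^+ 2) *
  ((cos x - cos y) ^+ 2 + (sin x - sin y) ^+ 2)); first by ring.
by rewrite cs mul1r.
Qed.

Lemma angle_add (R : realType) (n : nat) (a b : 'I_n.+1) :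
  cos (angle R n (a + b)%R) = cos (angle R n a + angle R n b) /\
  sin (angle R n (a + b)%R) = sin (angle R n a + angle R n b).
Proof.
have n0 : n.+1%:R != 0 :> R by rewrite pnatr_eq0.
have -> : angle R n a + angle R n b = angle R n (a + b)%N.
  by rewrite /angle natrD [2 * pi * (_ + _)]mulrDr mulrDl.
have -> : nat_of_ord (a + b)%R = ((a + b) %% n.+1)%N by [].
have [h|h] := ltnP (a + b)%N n.+1; first by rewrite modn_small.
have -> : ((a + b) %% n.+1 = a + b - n.+1)%N.
  rewrite -{1}(subnK h) modnDr modn_small //.
  by rewrite ltn_subLR //; apply: leq_ltn_trans (leq_add (leq_ord a) (leq_ord b)) _; rewrite addSn ltnS leq_add2l.
have -> : angle R n (a + b) = angle R n (a + b - n.+1) + pi *+ 2.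
  by rewrite -{1}(subnK h) /angle natrD [2 * pi * (_ + _)]mulrDr mulrDl mulfK // mulr_natl.
by rewrite cosD2pi sinD2pi.
Qed.

Lemma chord2_angle_add (R : realType) (n : nat) (s a b : 'I_n.+1) :
  chord2 (angle R n (s + a)%R) (angle R n (s + b)%R) =
  chord2 (angle R n a) (angle R n b).
Proof.
rewrite -[RHS](chord2_rot (angle R n s)) /chord2.
by have [-> ->] := angle_add R s a; have [-> ->] := angle_add R s b.
Qed.

(** The vector with first coordinate h whose other coordinates, indexed by X,
    are given by F. *)
Definition padded_row (R : realType) (X : finType) (h : R) (F : X -> R) :
    'rV[R]_(#|X|).+1 :=
  \row_i (if unlift ord0 i is Some k then F (enum_val k) else h).

Lemma dotp_padded_row (R : realType) (X : finType) (h : R) (F : X -> R) :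
  dotp (padded_row h F) (padded_row h F) = h ^+ 2 + \sum_x F x ^+ 2.
Proof.
rewrite /dotp big_ord_recl !mxE unlift_none; congr (_ + _).
rewrite [RHS](reindex_onto (@enum_val X xpredT) enum_rank) /=; last first.
  by move=> x _; exact: enum_rankK.
apply: eq_big => [k|k _]; first by rewrite enum_valK eqxx.
by rewrite !mxE liftK.
Qed.

Lemma padded_rowB (R : realType) (X : finType) (h : R) (F G : X -> R) :
  padded_row h F - padded_row h G = padded_row 0 (fun x => F x - G x).
Proof.
by apply/rowP => i; rewrite !mxE; case: unlift => [k|]; rewrite ?subrr.
Qed.

(** The point realizing the word x: each position p contributes a vector of
    length A * sqrt (w p) in its own plane, directed by the residue x p; the
    extra coordinate h brings the norm to the prescribed radius. *)
Definition word_point (R : realType) (n : nat) (T : finType) (w : T -> R)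
    (A h : R) (x : {ffun T -> 'I_n.+1}) :=
  padded_row h (fun q : T * bool => A * Num.sqrt (w q.1) *
    (if q.2 then cos (angle R n (x q.1)) else sin (angle R n (x q.1)))).

Lemma sum_pair_bool (R : realType) (T : finType) (F : T * bool -> R) :
  \sum_q F q = \sum_p (F (p, true) + F (p, false)).
Proof.
transitivity (\sum_q F (q.1, q.2)); first by apply: eq_bigr => -[].
rewrite -(pair_bigA _ (fun p b => F (p, b))) /=.
by apply: eq_bigr => p _; rewrite big_bool.
Qed.

Lemma enorm_word_point (R : realType) (n : nat) (T : finType) (w : T -> R)
    (A h : R) (x : {ffun T -> 'I_n.+1}) :
  (forall p, 0 <= w p) -> \sum_p w p = 1 ->
  enorm (word_point w A h x) = Num.sqrt (h ^+ 2 + A ^+ 2).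
Proof.
move=> w0 w1; rewrite /enorm dotp_padded_row sum_pair_bool; congr (Num.sqrt (_ + _)).
rewrite -[RHS]mulr1 -[in RHS]w1 mulr_sumr; apply: eq_bigr => p _ /=.
by rewrite !exprMn sqr_sqrtr // -mulrDr cos2Dsin2 mulr1.
Qed.

(** Rows of a template lie at the distances of the points of a regular polygon. *)
Lemma enorm_word_pointB (R : realType) (n : nat) (T : finType) (w : T -> R)
    (A h theta : R) (b : T -> bool * 'I_n.+1) (j k : 'I_n.+1) :
  (forall p, 0 <= w p) -> \sum_p w p * turn_mark R tt (b p) = theta ->
  enorm (word_point w A h [ffun p => turn (b p) j] -
         word_point w A h [ffun p => turn (b p) k]) =
  Num.sqrt (A ^+ 2 * theta * chord2 (angle R n j) (angle R n k)).
Proof.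
move=> w0 wth; rewrite /enorm padded_rowB dotp_padded_row sum_pair_bool.
rewrite expr0n add0r -wth; congr Num.sqrt.
rewrite mulr_sumr mulr_suml; apply: eq_bigr => p _ /=.
rewrite !ffunE -!mulrBr !exprMn sqr_sqrtr // -mulrDr -/(chord2 _ _).
rewrite -!mulrA; congr (_ * (_ * _)).
rewrite /turn /turn_mark; case: (b p) => -[] s /=.
  by rewrite mul1r chord2_angle_add.
by rewrite mul0r /chord2 !subrr !expr0n addr0.
Qed.

Lemma dotp_comb (R : realType) (d : nat) (a b : R) (u v : 'rV[R]_d) :
  dotp (a *: u + b *: v) (a *: u + b *: v) =
  a ^+ 2 * dotp u u + b ^+ 2 * dotp v v + 2 * a * b * dotp u v.
Proof.
rewrite /dotp !mulr_sumr -!big_split /=; apply: eq_bigr => i _.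
by rewrite !mxE; ring.
Qed.

Theorem corollary3 (R : realType) (d : nat) (P : set 'rV[R]_d) (rho : R) :
  regular_polygon_vertices rho P -> nearcircumsphere_Ramsey rho P.
Proof.
move=> [rho0 [m [c [u [v [m3 uu vv uv PE]]]]]] r eps eps0.
case: m m3 PE => // n _ PE.
have re0 : 0 < rho + eps by rewrite addr_gt0.
pose e := 1 - rho ^+ 2 / (rho + eps) ^+ 2.
have e0 : 0 < e.
  rewrite subr_gt0 ltr_pdivrMr ?exprn_gt0// mul1r ltrXn2r // ?nnegrE ?ltW//.
  by rewrite ltrDl.
have [theta [th0 the th1 mth]] := polygon_mergeable_near n e0.
have [T [w [w0 w1 col]]] := mth 'I_r.
(* The constant A is chosen so that the rows have circumradius rho; h fills the
   gap to rho + eps. *)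
pose A := rho / Num.sqrt theta.
have A2 : A ^+ 2 = rho ^+ 2 / theta by rewrite expr_div_n sqr_sqrtr // ltW.
have Ale : A ^+ 2 <= (rho + eps) ^+ 2.
  rewrite A2 ler_pdivrMr // -ler_pdivrMl ?exprn_gt0// mulrC.
  by move: the; rewrite /e subKr.
pose h := Num.sqrt ((rho + eps) ^+ 2 - A ^+ 2).
exists #|{: T * bool}| => chi.
have on_sphere x : sphere #|{: T * bool}| (rho + eps) (word_point (n := n) w A h x).
  rewrite /sphere /= enorm_word_point // /h sqr_sqrtr ?subr_ge0// subrK.
  by rewrite sqrtr_sqr gtr0_norm.
pose spt x : sphere #|{: T * bool}| (rho + eps) :=
  exist (fun y => y \in sphere #|{: T * bool}| (rho + eps))
    (word_point (n := n) w A h x) (mem_set (on_sphere x)).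
have [b [bth bcol]] := col (fun x => chi (spt x)).
pose row (k : nat) := word_point w A h [ffun p => turn (b p) (inord k : 'I_n.+1)].
pose pt (k : nat) := c + rho *: (cos (2 * pi * k%:R / n.+1%:R) *: u
                           + sin (2 * pi * k%:R / n.+1%:R) *: v).
have dist k l : (k < n.+1)%N -> (l < n.+1)%N ->
    enorm (row k - row l) = enorm (pt k - pt l).
  move=> kn ln; rewrite (enorm_word_pointB _ _ _ _ w0 (bth tt)) !inordK //.
  have -> : pt k - pt l =
      (rho * (cos (angle R n k) - cos (angle R n l))) *: u +
      (rho * (sin (angle R n k) - sin (angle R n l))) *: v.
    apply/rowP => i; rewrite /pt /angle !mxE.
    set ck := cos _; set sk := sin _; set cl := cos _; set sl := sin _.
    by ring.
  rewrite /enorm dotp_comb uu vv uv A2 /chord2; congr Num.sqrt.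
  by rewrite divfK ?gt_eqF//; ring.
pose idx (y : 'rV[R]_d) : nat := xget 0%N [set k | (k < n.+1)%N /\ pt k = y].
have idxP y : P y -> (idx y < n.+1)%N /\ pt (idx y) = y.
  rewrite PE => -[k kn ky]; rewrite /idx.
  by case: xgetP => [l _ //|/(_ k)]; case.
exists ((fun y => row (idx y)) @` P); split.
- exists (fun y => row (idx y)); split=> // x y Px Py.
  have [xn xE] := idxP x Px; have [yn yE] := idxP y Py.
  by rewrite dist // xE yE.
- by move=> _ [y _ <-]; exact: on_sphere.
exists (chi (spt [ffun p => turn (b p) 0])).
move=> x [y _ xE]; rewrite -(bcol (inord (idx y)) 0 Logic.I).
by congr chi; apply: val_inj; rewrite /= -xE.
Qed.
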